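(* Let $d$ be an odd prime, $n\ge1$, let $G=\begin{pmatrix} g_{00} & g_{01} \\ g_{10} & g_{11} \end{pmatrix}$ be an invertible matrix over $\mathbb Z_d$ that is even-parity positive, i.e. $g_{00}\ne0$ and $g_{11}\neq0$, and let $\sigma$ be a state on $(\mathbb C^d)^{\otimes n}$. Then the quantum convolutional channel $\Lambda_\sigma$ is unital and $$\chi(\Lambda_\sigma)=n\log d-\min_{|\psi\rangle}S\big(\Lambda_\sigma(|\psi\rangle\langle\psi|)\big),$$ where the minimum is over unit vectors $|\psi\rangle\in(\mathbb C^d)^{\otimes n}$.
   Context: All logarithms are base two. $S(\rho)=-\operatorname{tr}\rho\log\rho$ is the von Neumann entropy. Convolutional channel. With $N_G=(\det G)^{-1}\in\mathbb Z_d$, $U_G$ is the unitary on $\mathcal H_A\otimes\mathcal H_B$, $\mathcal H_A=\mathcal H_B=(\mathbb C^d)^{\otimes n}$, with $U_G|i,j\rangle=|N_Gg_{11}i-N_Gg_{10}j,\,-N_Gg_{01}i+N_Gg_{00}j\rangle$ for $i,j\in\mathbb Z_d^n$ (computational basis labelled by $\mathbb Z_d^n$). For a state $\sigma$ on $\mathcal H_B$, $\Lambda_\sigma(\rho)=\operatorname{tr}_B[U_G(\rho\otimes\sigma)U_G^\dagger]$. The one-shot Holevo information of a channel $\Lambda$ is $\chi(\Lambda)=\max_{\{p_i,\rho_i\}}\big[S(\Lambda(\sum_ip_i\rho_i))-\sum_ip_iS(\Lambda(\rho_i))\big]$, over finite ensembles of input states. *)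

(* Defs.v *)
From mathcomp Require Export all_boot all_order all_algebra.
From mathcomp Require Export classical_sets reals exp.
From mathcomp Require Export complex.

Set Implicit Arguments.
Unset Strict Implicit.
Unset Printing Implicit Defensive.

Import Order.TTheory GRing.Theory Num.Theory.
Local Open Scope ring_scope.
Local Open Scope sesquilinear_scope.
Local Open Scope complex_scope.

Definition is_maximum {R : realType} (A : set R) (m : R) : Prop :=
  A m /\ ubound A m.

Definition is_minimum {R : realType} (A : set R) (m : R) : Prop :=
  A m /\ lbound A m.

Section Quantum.
Context {R : realType}.
Local Notation C := R[i].

Definition log2 (x : R) : R := ln x / ln 2.

(* Functional calculus A = P^-1 diag(lambda) P |-> P^-1 diag(f lambda) P, where
   A is meant to be Hermitian, so that each lambda is real. *)
Definition mxfun n (f : R -> R) (A : 'M[C]_n) : 'M[C]_n :=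
  invmx (spectralmx A)
  *m diag_mx (map_mx (fun z : C => (f (complex.Re z))%:C) (spectral_diag A))
  *m spectralmx A.

(* Since ln 0 = 0, null eigenvalues contribute 0.  The trace is real when rho
   is Hermitian, so taking its real part only changes the type. *)
Definition entropy n (rho : 'M[C]_n) : R :=
  - complex.Re (\tr (rho *m mxfun log2 rho)).

Definition is_state n (rho : 'M[C]_n) : Prop :=
  [/\ rho \is hermsymmx,
      forall v : 'cV[C]_n, 0 <= (v^t* *m rho *m v) 0 0
    & \tr rho = 1].

Definition unit_ket n (psi : 'cV[C]_n) : Prop := (psi^t* *m psi) 0 0 = 1.

Definition proj_ket n (psi : 'cV[C]_n) : 'M[C]_n := psi *m psi^t*.

(* The space with computational basis labelled by a finite type I is
   'cV[C]_#|I|, and the tensor product of those labelled by I and J is the one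
   labelled by I * J. *)
Definition ket (I : finType) (x : I) : 'cV[C]_#|I| := delta_mx (enum_rank x) 0.

Definition tensor (I J : finType) (A : 'M[C]_#|I|) (B : 'M[C]_#|J|) :
    'M[C]_#|{: I * J}| :=
  \matrix_(x, y)
    (A (enum_rank (enum_val x).1) (enum_rank (enum_val y).1)
     * B (enum_rank (enum_val x).2) (enum_rank (enum_val y).2)).

Definition ptraceB (I J : finType) (X : 'M[C]_#|{: I * J}|) : 'M[C]_#|I| :=
  \matrix_(i, k)
    \sum_(j : J) X (enum_rank (enum_val i, j)) (enum_rank (enum_val k, j)).

Definition unital n (L : 'M[C]_n -> 'M[C]_n) : Prop := L 1%:M = 1%:M.

Definition holevo_quantities m n (L : 'M[C]_m -> 'M[C]_n) : set R :=
  [set x | exists (k : nat) (p : 'I_k -> R) (rho : 'I_k -> 'M[C]_m),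
     [/\ forall i, 0 <= p i,
         \sum_i p i = 1,
         forall i, is_state (rho i)
       & x = entropy (L (\sum_i (p i)%:C *: rho i))
             - \sum_i p i * entropy (L (rho i))]].

(* By itself only a supremum; that it is attained is to be asserted separately,
   with is_maximum (and likewise below for the infimum). *)
Definition holevo_information m n (L : 'M[C]_m -> 'M[C]_n) : R :=
  sup (holevo_quantities L).

Definition pure_output_entropies m n (L : 'M[C]_m -> 'M[C]_n) : set R :=
  [set x | exists2 psi : 'cV[C]_m,
     unit_ket psi & x = entropy (L (proj_ket psi))].

Definition min_output_entropy m n (L : 'M[C]_m -> 'M[C]_n) : R :=
  inf (pure_output_entropies L).

End Quantum.

(* 'F_d is Z_d only when d is prime. *)
Notation dits d n := 'rV['F_d]_n.

Definition even_parity_positive d (G : 'M['F_d]_2) : Prop :=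
  G 0 0 != 0 /\ G 1 1 != 0.

Section Convolution.
Context {R : realType} (d n : nat).
Local Notation C := R[i].
Implicit Type G : 'M['F_d]_2.

Definition conv_label G (i j : dits d n) : dits d n * dits d n :=
  let N := (\det G)^-1 in
  ((N * G 1 1) *: i - (N * G 1 0) *: j,
   - ((N * G 0 1) *: i) + (N * G 0 0) *: j).

Definition conv_unitary G : 'M[C]_#|{: dits d n * dits d n}| :=
  \sum_(i : dits d n) \sum_(j : dits d n)
    ket (conv_label G i j) *m (ket (i, j))^t*.

Definition conv_channel G (sigma rho : 'M[C]_#|{: dits d n}|) :
    'M[C]_#|{: dits d n}| :=
  ptraceB (conv_unitary G *m tensor rho sigma *m (conv_unitary G)^t*).

End Convolution.

(* Main.v *)
(* The entropy of a positive matrix A is the minimum, over unitaries U, of the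
   Shannon entropy of the diagonal of U A U^*: passing from the spectrum to
   another diagonal is averaging by a doubly stochastic matrix, and
   -x log x is concave.  Unitary invariance, concavity and the bound S <= log D
   are read off this formula, and so is the existence of an optimal ket:
   minimising S(L psi) over kets is minimising a continuous function of
   (U, psi) over a compact set.
   Entrywise, L rho (a, c) is the sum over b of
     rho (g00 a + g10 b, g00 c + g10 b) sigma (g01 a + g11 b, g01 c + g11 b),
   whence L is unital and intertwines conjugation by Weyl operators with
   conjugation by Weyl operators.  Concavity and S <= log D bound every Holevo
   quantity by n log d - min S; the uniform ensemble on the Weyl orbit of an
   optimal ket, which averages to the maximally mixed state, reaches the bound. *)
Require Import Defs.
From mathcomp Require Import ring lra.
From mathcomp Require Import boolp topology normedtype derive realfun.

Set Implicit Arguments.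
Unset Strict Implicit.
Unset Printing Implicit Defensive.

Import Order.TTheory GRing.Theory Num.Theory.
Import numFieldNormedType.Exports.
Local Open Scope ring_scope.
Local Open Scope sesquilinear_scope.
Local Open Scope complex_scope.
Local Open Scope classical_set_scope.

(** * Entropy *)

Section Eta.
Context {R : realType}.
Implicit Types x y : R.

(** Since [ln] is 0 on nonpositive reals, so is [eta]; it is thereby continuous on the whole
    line. *)
Definition eta x : R := - (x * log2 x).

Lemma ln2_gt0 : 0 < ln 2 :> R.
Proof. by apply: ln_gt0; lra. Qed.

(** The right-hand side is the tangent of [eta] at [y]; the bound is ln t <= t - 1 at t = y / x. *)
Lemma eta_le_tangent x y : 0 <= x -> 0 < y ->
  eta x <= (y - x - x * ln y) / ln 2.
Proof.
move=> x0 y0; have l0 := ln2_gt0.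
rewrite /eta /log2 mulrA -mulNr ler_pM2r ?invr_gt0 //.
have [->|xn] := eqVneq x 0; first by rewrite !mul0r !subr0 oppr0 ltW.
have xp : 0 < x by rewrite lt_neqAle eq_sym xn.
have h : ln (y / x) <= y / x - 1.
  have := @le_ln1Dx R (y / x - 1); rewrite addrCA subrr addr0; apply.
  by rewrite ltrBrDr addNr divr_gt0.
move: h; rewrite ln_div // => h.
have : x * (ln y - ln x) <= x * (y / x - 1) by rewrite ler_wpM2l.
have -> : x * (y / x - 1) = y - x by field.
lra.
Qed.

(** Average the tangent bound taken at the mean [y]: its linear terms collapse to [eta y]. The
    tangent needs [y > 0]; if the mean is 0, every [w i * x i] vanishes and both sides are 0. *)
Lemma eta_jensen (I : finType) (w x : I -> R) :
  (forall i, 0 <= w i) -> \sum_i w i = 1 -> (forall i, 0 <= x i) ->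
  \sum_i w i * eta (x i) <= eta (\sum_i w i * x i).
Proof.
move=> w0 w1 x0; set y := \sum_i w i * x i.
have y0 : 0 <= y by apply: sumr_ge0 => i _; apply: mulr_ge0.
have [yE|yn] := eqVneq y 0.
  rewrite yE /eta mul0r oppr0 big1 // => i _.
  have /eqP := yE; rewrite psumr_eq0 => [|j _]; last exact: mulr_ge0.
  move=> /allP /(_ i); rewrite mem_index_enum => /(_ isT) /eqP wx0.
  by rewrite mulrN mulrA wx0 mul0r oppr0.
have yp : 0 < y by rewrite lt_neqAle eq_sym yn.
apply: (@le_trans _ _ (\sum_i w i * ((y - x i - x i * ln y) / ln 2))).
  by apply: ler_sum => i _; apply: ler_wpM2l => //; apply: eta_le_tangent.
rewrite (eq_bigr (fun i => (w i * y - w i * x i * (1 + ln y)) / ln 2)); last first.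
  by move=> i _; ring.
rewrite -mulr_suml sumrB -!mulr_suml w1 -/y le_eqVlt; apply/orP; left.
by apply/eqP; rewrite /eta /log2; ring.
Qed.

(** Jensen with uniform weights, the mean being 1/n. *)
Lemma eta_sum_le (n : nat) (x : 'I_n -> R) : (0 < n)%N ->
  (forall i, 0 <= x i) -> \sum_i x i = 1 -> \sum_i eta (x i) <= log2 n%:R.
Proof.
move=> n0 x0 x1; have nn : 0 < n%:R :> R by rewrite ltr0n.
have := @eta_jensen _ (fun=> n%:R^-1) x.
rewrite -!mulr_sumr x1 mulr1 => /(_ _ _ x0).
rewrite sumr_const card_ord -[_^-1 *+ _]mulr_natr mulVf ?gt_eqF //.
have -> : eta n%:R^-1 = n%:R^-1 * log2 n%:R.
  by rewrite /eta /log2 lnV ?posrE // mulNr mulrN opprK.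
by rewrite ler_pM2l ?invr_gt0 //; apply=> // _; rewrite invr_ge0 ltW.
Qed.

End Eta.

(** * Positive matrices and the variational formula for entropy *)

Section Entropy.
Context {R : realType}.
Local Notation C := R[i].

Definition psd n (A : 'M[C]_n) : Prop :=
  A \is hermsymmx /\ forall v : 'cV[C]_n, 0 <= (v^t* *m A *m v) 0 0.

Lemma ReM_real (a : R) (z : C) : complex.Re (a%:C * z) = a * complex.Re z.
Proof. by case: z => b c; rewrite /= mul0r subr0. Qed.

Lemma Re_sum (I : Type) (r : seq I) (P : pred I) (F : I -> C) :
  complex.Re (\sum_(i <- r | P i) F i) = \sum_(i <- r | P i) complex.Re (F i).
Proof. by elim/big_ind2: _ => [//|x1 [a b] y1 [c d]|//] /= -> ->. Qed.

Lemma Re_ge0 (z : C) : 0 <= z -> 0 <= complex.Re z.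
Proof. by rewrite lecE => /andP[]. Qed.

Lemma ge0_RRe (z : C) : 0 <= z -> (complex.Re z)%:C = z.
Proof. by move=> z0; rewrite RRe_real ?ger0_real. Qed.

Lemma mulJC_ge0 (z : C) : 0 <= (z^*)%R * z.
Proof. by rewrite mulrC mul_conjC_ge0. Qed.

Lemma adjM m n p (A : 'M[C]_(m, n)) (B : 'M[C]_(n, p)) :
  (A *m B)^t* = B^t* *m A^t*.
Proof. by rewrite trmx_mul map_mxM. Qed.

Lemma hermsymP n (A : 'M[C]_n) : A = A^t* <-> A \is hermsymmx.
Proof.
split=> [h|/is_hermitianmxP]; last by rewrite expr0 scale1r.
by apply/is_hermitianmxP; rewrite expr0 scale1r.
Qed.

Lemma gram_psd m n (B : 'M[C]_(m, n)) : psd (B^t* *m B).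
Proof.
split; first by apply/hermsymP; rewrite adjM trmxCK.
move=> v; rewrite mulmxA -adjM -mulmxA mxE sumr_ge0 // => i _.
by rewrite !mxE mulJC_ge0.
Qed.

Lemma psd_conj m n (A : 'M[C]_n) (V : 'M[C]_(m, n)) :
  psd A -> psd (V *m A *m V^t* ).
Proof.
move=> [/hermsymP hA pA]; split.
  by apply/hermsymP; rewrite !adjM trmxCK -hA mulmxA.
by move=> v; have := pA (V^t* *m v); rewrite adjM trmxCK !mulmxA.
Qed.

Lemma psd_diag_ge0 n (A : 'M[C]_n) i : psd A -> 0 <= A i i.
Proof.
case=> _ /(_ (delta_mx i 0)).
by rewrite -colE trmx_delta map_delta_mx -rowE !mxE.
Qed.

Lemma diag_mx_psdP n (d : 'rV[C]_n) : psd (diag_mx d) -> forall i, 0 <= d 0 i.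
Proof. by move=> h i; have := psd_diag_ge0 i h; rewrite mxE eqxx mulr1n. Qed.

Lemma spectralE n (A : 'M[C]_n) : A \is hermsymmx ->
  A = (spectralmx A)^t* *m diag_mx (spectral_diag A) *m spectralmx A.
Proof.
move=> /hermitian_normalmx /orthomx_spectralP {1}->.
by rewrite invmx_unitary // spectral_unitarymx.
Qed.

Lemma unitary_mulVmx n (P : 'M[C]_n) : P \is unitarymx -> P^t* *m P = 1%:M.
Proof. by rewrite -trmxC_unitary => /unitarymxP; rewrite trmxCK. Qed.

Lemma unitary_mulmxV n (P : 'M[C]_n) : P \is unitarymx -> P *m P^t* = 1%:M.
Proof. by move=> /unitarymxP. Qed.

Lemma spectral_diagE n (A : 'M[C]_n) : A \is hermsymmx ->
  spectralmx A *m A *m (spectralmx A)^t* = diag_mx (spectral_diag A).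
Proof.
move=> hA; rewrite {2}(spectralE hA) !mulmxA.
rewrite unitary_mulmxV ?spectral_unitarymx // mul1mx.
by rewrite -mulmxA unitary_mulmxV ?spectral_unitarymx // mulmx1.
Qed.

Definition diag_entropy n (A : 'M[C]_n) : R := \sum_i eta (complex.Re (A i i)).

(** The eigenbasis attains the minimum in the variational formula; [entropy_le_diag] is the other
    half. *)
Lemma entropy_spectral n (A : 'M[C]_n) : A \is hermsymmx ->
  entropy A = diag_entropy (spectralmx A *m A *m (spectralmx A)^t* ).
Proof.
move=> hA; rewrite /diag_entropy spectral_diagE // /entropy /mxfun.
set f := diag_mx (map_mx _ _).
rewrite {1}(spectralE hA); set P := spectralmx A; set D := diag_mx _.
have uP : P \is unitarymx := spectral_unitarymx A.
rewrite !mulmxA mulmxK ?unitarymx_unit // mxtrace_mulC !mulmxA.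
rewrite unitary_mulmxV // mul1mx mulmx_diag /mxtrace Re_sum -sumrN.
apply: eq_bigr => i _.
by rewrite !mxE eqxx !mulr1n mulrC ReM_real /eta mulrC.
Qed.

Lemma unitary_row_sum n (V : 'M[C]_n) i : V \is unitarymx ->
  \sum_j V i j * ((V i j)^*)%R = 1.
Proof.
move=> /unitarymxP /matrixP /(_ i i); rewrite !mxE eqxx; apply: etrans.
by apply: eq_bigr => j _; rewrite !mxE.
Qed.

Lemma unitary_col_sum n (V : 'M[C]_n) j : V \is unitarymx ->
  \sum_i V i j * ((V i j)^*)%R = 1.
Proof.
rewrite -trmx_unitary => /(unitary_row_sum j) <-.
by apply: eq_bigr => i _; rewrite !mxE.
Qed.

Lemma unitary_diagE n (V : 'M[C]_n) (d : 'rV[C]_n) i :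
  (V *m diag_mx d *m V^t* ) i i = \sum_j V i j * ((V i j)^*)%R * d 0 j.
Proof.
rewrite mxE; apply: eq_bigr => j _; rewrite mul_mx_diag !mxE.
by rewrite mulrAC.
Qed.

(* The diagonal of V diag(d) V^* is the image of d under the doubly stochastic
   matrix |V_ij|^2. *)
Lemma diag_entropy_ge n (V : 'M[C]_n) (d : 'rV[C]_n) :
  V \is unitarymx -> (forall i, 0 <= d 0 i) ->
  diag_entropy (diag_mx d) <= diag_entropy (V *m diag_mx d *m V^t* ).
Proof.
move=> uV d0; rewrite /diag_entropy.
pose w i j := complex.Re (V i j * ((V i j)^*)%R).
have wE i j : (w i j)%:C = V i j * ((V i j)^*)%R.
  by rewrite ge0_RRe ?mul_conjC_ge0.
have w0 i j : 0 <= w i j by rewrite Re_ge0 ?mul_conjC_ge0.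
apply: (@le_trans _ _ (\sum_i \sum_j w i j * eta (complex.Re (d 0 j)))).
  rewrite exchange_big /=; apply: ler_sum => j _.
  rewrite -mulr_suml -Re_sum unitary_col_sum // mul1r.
  by rewrite mxE eqxx mulr1n.
apply: ler_sum => i _; rewrite unitary_diagE Re_sum.
rewrite [X in _ <= eta X](eq_bigr (fun j => w i j * complex.Re (d 0 j))); last first.
  by move=> j _; rewrite -wE ReM_real.
apply: eta_jensen => // [|j]; last exact: Re_ge0.
by rewrite -Re_sum unitary_row_sum.
Qed.

(** With P the spectral unitary of [A], the matrix on the right is the spectrum of [A] conjugated by
    the unitary V P^*, so [diag_entropy_ge] applies. *)
Lemma entropy_le_diag n (A V : 'M[C]_n) : psd A -> V \is unitarymx ->
  entropy A <= diag_entropy (V *m A *m V^t* ).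
Proof.
move=> pA uV; have [hA _] := pA.
have := entropy_spectral hA; rewrite (spectral_diagE hA) => ->.
set P := spectralmx A; have uP : P \is unitarymx := spectral_unitarymx A.
have d0 : forall i, 0 <= spectral_diag A 0 i.
  by apply: diag_mx_psdP; rewrite -(spectral_diagE hA); apply: psd_conj.
rewrite [in leRHS](spectralE hA) -/P.
move: (spectral_diag A) P uP d0 => d P uP d0.
have -> : V *m (P^t* *m diag_mx d *m P) *m V^t*
    = (V *m P^t* ) *m diag_mx d *m (V *m P^t* )^t*.
  by rewrite adjM trmxCK !mulmxA.
apply: diag_entropy_ge d0; apply: mul_unitarymx uV _.
by rewrite trmxC_unitary.
Qed.

(** If P diagonalises [A], then P V^* diagonalises V A V^* with the same diagonal, so it is a good
    test unitary for the conjugate. *)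
Lemma entropy_unitary_le n (A V : 'M[C]_n) : psd A -> V \is unitarymx ->
  entropy (V *m A *m V^t* ) <= entropy A.
Proof.
move=> pA uV; have [hA _] := pA; rewrite [leRHS](entropy_spectral hA).
have := spectral_unitarymx A; move: (spectralmx A) => P uP.
have uPV : P *m V^t* \is unitarymx.
  by apply: mul_unitarymx uP _; rewrite trmxC_unitary.
apply: le_trans (entropy_le_diag (psd_conj V pA) uPV) _.
suff -> : P *m V^t* *m (V *m A *m V^t* ) *m (P *m V^t* )^t* = P *m A *m P^t*.
  exact: lexx.
rewrite adjM trmxCK !mulmxA -[P *m _ *m V]mulmxA (unitary_mulVmx uV) mulmx1.
by rewrite -[X in X *m _ = _]mulmxA (unitary_mulVmx uV) mulmx1.
Qed.

Lemma entropy_unitary n (A V : 'M[C]_n) : psd A -> V \is unitarymx ->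
  entropy (V *m A *m V^t* ) = entropy A.
Proof.
move=> pA uV; apply: le_anti; apply/andP; split.
  exact: entropy_unitary_le.
have uV' : V^t* \is unitarymx by rewrite trmxC_unitary.
suff {1}-> : A = V^t* *m (V *m A *m V^t* ) *m V^t*^t*.
  exact: entropy_unitary_le (psd_conj V pA) uV'.
rewrite trmxCK !mulmxA (unitary_mulVmx uV) mul1mx.
by rewrite -mulmxA (unitary_mulVmx uV) mulmx1.
Qed.

Lemma psdD n (A B : 'M[C]_n) : psd A -> psd B -> psd (A + B).
Proof.
move=> [/hermsymP hA pA] [/hermsymP hB pB]; split.
  by apply/hermsymP; rewrite raddfD map_mxD -hA -hB.
by move=> v; rewrite mulmxDr mulmxDl mxE addr_ge0.
Qed.

Lemma psd0 n : psd (0 : 'M[C]_n).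
Proof.
split; first by apply/hermsymP; rewrite raddf0 map_mx0.
by move=> v; rewrite mulmx0 mul0mx mxE.
Qed.

Lemma psd_sum n (I : Type) (r : seq I) (F : I -> 'M[C]_n) :
  (forall i, psd (F i)) -> psd (\sum_(i <- r) F i).
Proof.
move=> pF; apply: (big_ind (@psd n)); [exact: psd0|exact: psdD|].
by move=> i _; apply: pF.
Qed.

Lemma psdZ n (a : R) (A : 'M[C]_n) : 0 <= a -> psd A -> psd (a%:C *: A).
Proof.
move=> a0 [/hermsymP hA pA]; split.
  apply/hermsymP; rewrite linearZ map_mxZ /= -hA; congr (_ *: _).
  by rewrite (CrealP _) // ger0_real // ler0c.
by move=> v; rewrite -scalemxAr -scalemxAl mxE mulr_ge0 // ler0c.
Qed.

(** Work in an eigenbasis of the mixture: there each [rho i] has entropy at most that of its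
    diagonal, and the diagonals average to the spectrum of the mixture, so Jensen applies entry by
    entry. *)
Lemma entropy_concave n (I : finType) (p : I -> R) (rho : I -> 'M[C]_n) :
  (forall i, 0 <= p i) -> \sum_i p i = 1 -> (forall i, psd (rho i)) ->
  \sum_i p i * entropy (rho i) <= entropy (\sum_i (p i)%:C *: rho i).
Proof.
move=> p0 p1 pr; set S := \sum_i (p i)%:C *: rho i.
have pS : psd S by apply: psd_sum => i; apply: psdZ.
have [hS _] := pS.
rewrite entropy_spectral //; set P := spectralmx S.
have uP : P \is unitarymx := spectral_unitarymx S.
apply: (@le_trans _ _ (\sum_i p i * diag_entropy (P *m rho i *m P^t* ))).
  apply: ler_sum => i _; apply: (ler_wpM2l (p0 i)).
  exact: entropy_le_diag (pr i) uP.
rewrite /diag_entropy.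
under eq_bigr do rewrite mulr_sumr.
rewrite exchange_big; apply: ler_sum => k _.
have -> : complex.Re ((P *m S *m P^t* ) k k)
   = \sum_i p i * complex.Re ((P *m rho i *m P^t* ) k k).
  rewrite /S mulmx_sumr mulmx_suml summxE Re_sum; apply: eq_bigr => i _.
  by rewrite -scalemxAr -scalemxAl mxE ReM_real.
apply: eta_jensen p0 p1 _ => i; apply/Re_ge0/psd_diag_ge0.
exact: psd_conj (pr i).
Qed.

Lemma state_psd n (A : 'M[C]_n) : is_state A <-> psd A /\ \tr A = 1.
Proof. by split=> [[]|[[]]]. Qed.

Lemma entropy_le_log n (A : 'M[C]_n) : (0 < n)%N -> is_state A ->
  entropy A <= log2 n%:R.
Proof.
move=> n0 [hA pA tA]; have pp : psd A by split.
rewrite entropy_spectral // /diag_entropy.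
set P := spectralmx A; have uP : P \is unitarymx := spectral_unitarymx A.
apply: eta_sum_le => //; first by move=> i; apply/Re_ge0/psd_diag_ge0/psd_conj.
rewrite -Re_sum -/(mxtrace _) mxtrace_mulC mulmxA (unitary_mulVmx uP).
by rewrite mul1mx tA.
Qed.

(** A scalar matrix is fixed by every unitary conjugation, so the spectral unitary need not be
    known. *)
Lemma entropy_maximally_mixed n : (0 < n)%N ->
  entropy ((n%:R^-1)%:C *: 1%:M : 'M[C]_n) = log2 n%:R.
Proof.
move=> n0; have nn : 0 < n%:R :> R by rewrite ltr0n.
have h1 : psd (1%:M : 'M[C]_n).
  have := gram_psd (1%:M : 'M[C]_n).
  by rewrite trmx1 map_mx1 mulmx1.
have pp : psd ((n%:R^-1)%:C *: 1%:M : 'M[C]_n).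
  by apply: psdZ => //; rewrite invr_ge0 ltW.
have [h _] := pp; rewrite entropy_spectral //.
have := spectral_unitarymx ((n%:R^-1)%:C *: 1%:M : 'M[C]_n).
move: (spectralmx _) => P uP.
rewrite -scalemxAr -scalemxAl mulmx1 unitary_mulmxV // /diag_entropy.
under eq_bigr do rewrite !mxE eqxx mulr1.
rewrite sumr_const card_ord /= -[_ *+ _]mulr_natr /eta /log2 lnV ?posrE //.
by field; rewrite gt_eqF ?ln2_gt0 ?gt_eqF.
Qed.

End Entropy.

(** * Continuity of -x log x *)

Section EtaContinuous.
Context {R : realType}.

(** This controls [eta] near 0. With s the square root of y, -y ln y = 2 s^2 ln(1/s) <= 2 (s - s^2)
    <= 2 s; for y <= 0 the left side is 0. *)
Lemma eta_norm_le (y : R) : y < 1 -> `|eta y| <= 2 / ln 2 * Num.sqrt y.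
Proof.
move=> y1; have l2 := @ln2_gt0 R; rewrite /eta /log2.
have [y0|y0] := leP y 0.
  by rewrite ln0 // mul0r mulr0 oppr0 normr0 mulr_ge0 ?sqrtr_ge0 // divr_ge0 ?ltW.
have s0 : 0 < Num.sqrt y by rewrite sqrtr_gt0.
have lny : ln y <= 0 by rewrite ln_le0 // ltW.
set s := Num.sqrt y in s0 *; have ys : y = s ^+ 2 by rewrite sqr_sqrtr // ltW.
have ls : ln s^-1 <= s^-1 - 1.
  have := @le_ln1Dx R (s^-1 - 1); rewrite addrCA subrr addr0; apply.
  by rewrite ltrBrDr addNr invr_gt0.
rewrite lnV ?posrE // in ls.
rewrite mulrA normrN normrM (@gtr0_norm _ (ln 2)^-1) ?invr_gt0 //.
rewrite [leRHS]mulrAC ler_pM2r ?invr_gt0 // normrM gtr0_norm // ler0_norm //.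
rewrite ys lnXn // -mulr_natl.
have : s ^+ 2 * (- ln s) <= s ^+ 2 * (s^-1 - 1).
  by rewrite ler_wpM2l // exprn_ge0 // ltW.
have -> : s ^+ 2 * (s^-1 - 1) = s - s ^+ 2 by field; rewrite gt_eqF.
have : 0 <= s ^+ 2 by rewrite exprn_ge0 // ltW.
lra.
Qed.

Lemma eta_continuous : continuous (@eta R).
Proof.
move=> x; have [x0|x0] := ltP 0 x.
  rewrite /eta /log2; apply: cvgN; apply: cvgM; first exact: cvg_id.
  by apply: cvgM; [exact: continuous_ln|exact: cvg_cst].
have e0 : eta x = 0 by rewrite /eta /log2 ln0 // mul0r mulr0 oppr0.
rewrite /continuous_at e0; apply/norm_cvg0P.
(* [Num.sqrt] is continuous and vanishes at every x <= 0, so one squeeze covers both 0 and the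
   negative reals. *)
apply: (@squeeze_cvgr _ _ _ _ (fun=> 0) (fun y => 2 / ln 2 * Num.sqrt y)).
- near=> y; rewrite normr_ge0 /=; apply: eta_norm_le.
  near: y; apply: lt_nbhsl; exact: le_lt_trans x0 ltr01.
- exact: cvg_cst.
- rewrite -[X in _ --> X](mulr0 (2 / ln 2 : R)).
  apply: cvgM; first exact: cvg_cst.
  have := @sqrt_continuous R x.
  by rewrite /continuous_at (ler0_sqrtr x0).
Unshelve. all: by end_near. Qed.

End EtaContinuous.

(** * Continuity of complex-valued and matrix-valued maps *)

Section ComplexContinuous.
Context {R : realType} {T : topologicalType}.
Local Notation C := R[i].
Implicit Types F H : T -> C.

(* Continuity of complex-valued maps, stated through real and imaginary parts
   because R[i] carries no topology here. *)
Definition ccontinuous F : Prop :=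
  continuous (fun t => complex.Re (F t) : R) /\
  continuous (fun t => complex.Im (F t) : R).

Lemma ccontinuous_cst (c : C) : ccontinuous (fun=> c).
Proof. by split=> t; apply: cvg_cst. Qed.

Lemma ccontinuousD F H : ccontinuous F -> ccontinuous H ->
  ccontinuous (fun t => F t + H t).
Proof.
move=> [cF1 cF2] [cH1 cH2]; split.
- rewrite (_ : (fun t => _) = fun t => complex.Re (F t) + complex.Re (H t)).
    by move=> t; apply: cvgD; [exact: cF1|exact: cH1].
  by apply/funext => t; case: (F t) (H t) => ? ? [].
- rewrite (_ : (fun t => _) = fun t => complex.Im (F t) + complex.Im (H t)).
    by move=> t; apply: cvgD; [exact: cF2|exact: cH2].
  by apply/funext => t; case: (F t) (H t) => ? ? [].
Qed.

Lemma ccontinuousM F H : ccontinuous F -> ccontinuous H ->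
  ccontinuous (fun t => F t * H t).
Proof.
move=> [cF1 cF2] [cH1 cH2]; split.
- rewrite (_ : (fun t => _) = fun t => complex.Re (F t) * complex.Re (H t)
      - complex.Im (F t) * complex.Im (H t)).
    move=> t; apply: cvgB; apply: cvgM;
    [exact: cF1|exact: cH1|exact: cF2|exact: cH2].
  by apply/funext => t; case: (F t) (H t) => ? ? [].
- rewrite (_ : (fun t => _) = fun t => complex.Re (F t) * complex.Im (H t)
      + complex.Im (F t) * complex.Re (H t)).
    move=> t; apply: cvgD; apply: cvgM;
    [exact: cF1|exact: cH2|exact: cF2|exact: cH1].
  by apply/funext => t; case: (F t) (H t) => ? ? [].
Qed.

Lemma ccontinuousJ F : ccontinuous F -> ccontinuous (fun t => ((F t)^*)%R).
Proof.
move=> [cF1 cF2]; split.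
- rewrite (_ : (fun t => _) = fun t => complex.Re (F t)) //.
  by apply/funext => t; case: (F t).
- rewrite (_ : (fun t => _) = fun t => - complex.Im (F t)).
    by move=> t; apply: cvgN; exact: cF2.
  by apply/funext => t; case: (F t).
Qed.

Lemma ccontinuous_sum (I : Type) (r : seq I) (F : I -> T -> C) :
  (forall i, ccontinuous (F i)) -> ccontinuous (fun t => \sum_(i <- r) F i t).
Proof.
move=> cF; elim: r => [|i r IHr].
  rewrite (_ : (fun t => _) = fun=> 0); first exact: ccontinuous_cst.
  by apply/funext => t; rewrite big_nil.
rewrite (_ : (fun t => _) = fun t => F i t + \sum_(j <- r) F j t).
  exact: ccontinuousD.
by apply/funext => t; rewrite big_cons.
Qed.

Lemma closed_ccontinuous_eq F (c : C) :
  ccontinuous F -> closed [set t | F t = c].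
Proof.
move=> [cF1 cF2].
rewrite (_ : [set t | _] =
    (fun t => complex.Re (F t) : R) @^-1` [set complex.Re c]
    `&` (fun t => complex.Im (F t) : R) @^-1` [set complex.Im c]).
  by apply: closedI; apply: preimage_closed => //; exact: closed_eq.
apply/seteqP; split=> t /=; first by move=> ->.
by case: (F t) c => [a b] [a' b'] /= [-> ->].
Qed.

Definition mcontinuous m n (A : T -> 'M[C]_(m, n)) : Prop :=
  forall i j, ccontinuous (fun t => A t i j).

Lemma mcontinuousM m n p (A : T -> 'M[C]_(m, n)) (B : T -> 'M[C]_(n, p)) :
  mcontinuous A -> mcontinuous B -> mcontinuous (fun t => A t *m B t).
Proof.
move=> cA cB i j.
rewrite (_ : (fun t => _) = fun t => \sum_k A t i k * B t k j).
  by apply: ccontinuous_sum => k; apply: ccontinuousM.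
by apply/funext => t; rewrite mxE.
Qed.

Lemma mcontinuous_adj m n (A : T -> 'M[C]_(m, n)) :
  mcontinuous A -> mcontinuous (fun t => (A t)^t* ).
Proof.
move=> cA i j; rewrite (_ : (fun t => _) = fun t => ((A t j i)^*)%R).
  exact: ccontinuousJ.
by apply/funext => t; rewrite !mxE.
Qed.

Lemma continuous_diag_entropy n (A : T -> 'M[C]_n) :
  mcontinuous A -> continuous (fun t => diag_entropy (A t)).
Proof.
move=> cA t; apply: cvg_big => [|i _]; first exact: add_continuous.
have [cR _] := cA i i.
apply: continuous_comp; [exact: cR|exact: eta_continuous].
Qed.

End ComplexContinuous.

(** * Existence of a ket of minimal output entropy *)

Section MinimumAttained.
Context {R : realType} (m n : nat).
Local Notation C := R[i].
(** A pair of a square matrix ([inl]) and a vector ([inr]) is encoded by the real ([true]) and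
    imaginary ([false]) parts of its entries, a point of a product of real lines, where Tychonoff's
    theorem gives compact boxes. *)
Local Notation idx := (('I_n * 'I_n + 'I_m) * bool)%type.
Local Notation coords := (prod_topology (fun _ : idx => R)).

Let mat (t : coords) : 'M[C]_n :=
  \matrix_(i, j) (t (inl (i, j), true) +i* t (inl (i, j), false)).

Let vec (t : coords) : 'cV[C]_m :=
  \col_i (t (inr i, true) +i* t (inr i, false)).

Let coords_of (U : 'M[C]_n) (psi : 'cV[C]_m) : coords := fun x =>
  let z := match x.1 with inl ij => U ij.1 ij.2 | inr i => psi i 0 end in
  if x.2 then complex.Re z else complex.Im z.

Let coords_ofK U psi : mat (coords_of U psi) = U /\ vec (coords_of U psi) = psi.
Proof.
split; first by apply/matrixP => i j; rewrite mxE /coords_of /=; case: (U i j).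
by apply/matrixP => i j; rewrite mxE ord1 /coords_of /=; case: (psi i 0).
Qed.

Let coord_continuous (x : idx) : continuous (fun t : coords => t x : R).
Proof. exact: (@proj_continuous _ (fun _ : idx => R) x). Qed.

Let mat_continuous : mcontinuous mat.
Proof.
move=> i j; split.
- rewrite (_ : (fun t => _) = fun t : coords => t (inl (i, j), true) : R).
    exact: coord_continuous.
  by apply/funext => t; rewrite mxE.
- rewrite (_ : (fun t => _) = fun t : coords => t (inl (i, j), false) : R).
    exact: coord_continuous.
  by apply/funext => t; rewrite mxE.
Qed.

Let vec_continuous : mcontinuous vec.
Proof.
move=> i j; split.
- rewrite (_ : (fun t => _) = fun t : coords => t (inr i, true) : R).
    exact: coord_continuous.
  by apply/funext => t; rewrite mxE.
- rewrite (_ : (fun t => _) = fun t : coords => t (inr i, false) : R).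
    exact: coord_continuous.
  by apply/funext => t; rewrite mxE.
Qed.

Let unitary_unit : set coords :=
  [set t | mat t *m (mat t)^t* = 1%:M /\ unit_ket (vec t)].

Let closed_unitary_unit : closed unitary_unit.
Proof.
rewrite (_ : unitary_unit =
    (\bigcap_(ij in [set: 'I_n * 'I_n])
      [set t | (mat t *m (mat t)^t* ) ij.1 ij.2 = (1%:M : 'M[C]_n) ij.1 ij.2])
    `&` [set t | ((vec t)^t* *m vec t) 0 0 = 1]).
  apply: closedI.
    apply: closed_bigI => -[i j] _; apply: closed_ccontinuous_eq.
    exact: (mcontinuousM mat_continuous (mcontinuous_adj mat_continuous)).
  apply: closed_ccontinuous_eq.
  exact: (mcontinuousM (mcontinuous_adj vec_continuous) vec_continuous).
apply/seteqP; split=> t [h1 h2]; split=> //.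
  by move=> ij _ /=; rewrite h1.
by apply/matrixP => i j; apply: (h1 (i, j)).
Qed.

Let normCle1_box (z : C) : z * (z^*)%R <= 1 ->
  (- 1 <= complex.Re z <= 1) && (- 1 <= complex.Im z <= 1).
Proof.
case: z => a b; rewrite lecE /= => /andP[_]; rewrite mulrN opprK => h.
have := sqr_ge0 a; have := sqr_ge0 b; rewrite !expr2 => ha hb.
by apply/andP; split; apply/andP; split; nra.
Qed.

(** Squared moduli sum to 1 along each row of a unitary and along a unit vector, so every entry has
    modulus at most 1. *)
Let unitary_unit_box (t : coords) :
  unitary_unit t -> forall x, `[(- 1 : R), 1] (t x).
Proof.
move=> [/unitarymxP hU hp] [[[i j]|i] b].
- have : mat t i j * ((mat t i j)^*)%R <= 1.
    rewrite -(unitary_row_sum i hU) (bigD1 j) //= lerDl sumr_ge0 // => k _.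
    exact: mul_conjC_ge0.
  move=> /normCle1_box; rewrite mxE /= => /andP[h1 h2].
  by case: b; rewrite /= in_itv /=.
- have : vec t i 0 * ((vec t i 0)^*)%R <= 1.
    have <- : \sum_k vec t k 0 * ((vec t k 0)^*)%R = 1.
      rewrite -[RHS]hp [RHS]mxE; apply: eq_bigr => k _.
      by rewrite [in RHS]mxE [in RHS]mxE mulrC.
    rewrite (bigD1 i) //= lerDl sumr_ge0 // => k _; exact: mul_conjC_ge0.
  move=> /normCle1_box; rewrite mxE /= => /andP[h1 h2].
  by case: b; rewrite /= in_itv /=.
Qed.

Let compact_unitary_unit : compact unitary_unit.
Proof.
apply: (@subclosed_compact _ _
  [set t : coords | forall x, `[(- 1 : R), 1] (t x)]).
- exact: closed_unitary_unit.
- apply: (@tychonoff _ (fun _ : idx => R) (fun=> `[(- 1 : R), 1])) => _.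
  exact: segment_compact.
- exact: unitary_unit_box.
Qed.

(** Adding the unitary as a variable avoids any question of continuity of the spectral
    decomposition: [H] is visibly continuous in both variables. The expansion of [L] on matrix units
    provides linearity, hence continuity in the ket. *)
Lemma min_output_attained (L : 'M[C]_m -> 'M[C]_n) :
  (exists psi : 'cV[C]_m, unit_ket psi) ->
  (forall A i j, L A i j = \sum_k \sum_l A k l * L (delta_mx k l) i j) ->
  (forall psi, unit_ket psi -> psd (L (proj_ket psi))) ->
  exists2 psi, unit_ket psi &
    forall phi, unit_ket phi ->
      entropy (L (proj_ket psi)) <= entropy (L (proj_ket phi)).
Proof.
move=> [psi0 upsi0] Llin Lpsd.
pose H (t : coords) :=
  diag_entropy (mat t *m L (proj_ket (vec t)) *m (mat t)^t* ).
have cH : continuous H.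
  apply: continuous_diag_entropy; apply: mcontinuousM.
    2: exact: mcontinuous_adj mat_continuous.
  apply: mcontinuousM; first exact: mat_continuous.
  move=> i j; rewrite (_ : (fun t => _) = fun t : coords =>
      \sum_k \sum_l proj_ket (vec t) k l * L (delta_mx k l) i j).
    apply: ccontinuous_sum => k; apply: ccontinuous_sum => l.
    apply: ccontinuousM; last exact: ccontinuous_cst.
    exact: (mcontinuousM vec_continuous (mcontinuous_adj vec_continuous)).
  by apply/funext => t; rewrite Llin.
have K U psi : U \is unitarymx -> unit_ket psi -> unitary_unit (coords_of U psi).
  move=> /unitarymxP uU upsi; have [E1 E2] := coords_ofK U psi.
  by split; rewrite ?E1 ?E2.
have K0 : unitary_unit !=set0.
  exists (coords_of 1%:M psi0); apply: K => //.
  by apply/unitarymxP; rewrite trmx1 map_mx1 mulmx1.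
have [t0 t0K t0min] := compact_EVT_min K0 compact_unitary_unit
  (continuous_subspaceT cH).
have [/unitarymxP u0 p0] : unitary_unit t0 by rewrite inE in t0K.
exists (vec t0); first exact: p0.
move=> phi uphi.
(* The entropy at the minimiser is at most [H t0], while for [phi] the spectral unitary makes [H]
   equal to the entropy. *)
apply: le_trans (entropy_le_diag (Lpsd _ p0) u0) _.
have [hL _] := Lpsd _ uphi; rewrite [leRHS](entropy_spectral hL).
have := spectral_unitarymx (L (proj_ket phi)); move: (spectralmx _) => P uP.
have := t0min (coords_of P phi); rewrite inE => /(_ (K _ _ uP uphi)).
by have [E1 E2] := coords_ofK P phi; rewrite /H E1 E2.
Qed.

End MinimumAttained.

(** * The convolutional channel *)

Lemma sum_enum_rank (V : nmodType) (I : finType) (F : 'I_#|I| -> V) :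
  \sum_i F i = \sum_(x : I) F (enum_rank x).
Proof. exact: reindex (onW_bij _ (enum_rank_bij I)). Qed.

Lemma matrix_enum_rankP (T : Type) (I J : finType) (A B : 'M[T]_(#|I|, #|J|)) :
  (forall x y, A (enum_rank x) (enum_rank y) = B (enum_rank x) (enum_rank y)) ->
  A = B.
Proof.
by move=> h; apply/matrixP => i j; rewrite -(enum_valK i) -(enum_valK j).
Qed.

(** * Monomial matrices: permutations with coefficients *)

Section Monomial.
Context {R : realType} {I : finType}.
Local Notation C := R[i].
(** [U] sends the basis ket of y to c (f y) times that of f y. The convolution unitary (c = 1) and
    the Weyl operators both have this form. *)
Variables (f g : I -> I) (c : I -> C) (U : 'M[C]_#|I|).
Hypothesis fK : cancel f g.
Hypothesis gK : cancel g f.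
Hypothesis UE : forall x y, U (enum_rank x) (enum_rank y) = c x * (x == f y)%:R.

Lemma monomial_mulE (T : 'M[C]_#|I|) x j :
  (U *m T) (enum_rank x) j = c x * T (enum_rank (g x)) j.
Proof.
rewrite mxE sum_enum_rank (bigD1 (g x)) //= UE gK eqxx mulr1.
rewrite big1 ?addr0 // => y.
rewrite UE; have [->|_] := eqVneq x (f y); last by rewrite mulr0 mul0r.
by rewrite fK eqxx.
Qed.

Lemma monomial_conjE (T : 'M[C]_#|I|) x y :
  (U *m T *m U^t* ) (enum_rank x) (enum_rank y)
  = c x * ((c y)^*)%R * T (enum_rank (g x)) (enum_rank (g y)).
Proof.
rewrite mxE sum_enum_rank (bigD1 (g y)) //= monomial_mulE !mxE UE gK eqxx mulr1.
rewrite big1 ?addr0 => [|z zy].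
  by rewrite mulrAC.
rewrite !mxE UE; have [yz|_] := eqVneq y (f z); last first.
  by rewrite mulr0 rmorph0 mulr0.
by rewrite yz fK eqxx in zy.
Qed.

Lemma monomial_unitary : (forall x, c x * ((c x)^*)%R = 1) -> U \is unitarymx.
Proof.
move=> c1; apply/unitarymxP/matrix_enum_rankP => x y.
have := monomial_conjE 1%:M x y; rewrite mulmx1 => ->.
rewrite !mxE !(can_eq enum_rankK) (can_eq gK).
have [->|_] := eqVneq x y; first by rewrite c1 mulr1.
by rewrite mulr0.
Qed.

End Monomial.

Section Gram.
Context {R : realType}.
Local Notation C := R[i].

(** B is the square root of the spectrum times the spectral unitary. This serves to write channel
    outputs as sums of Gram matrices. *)
Lemma psd_gram n (A : 'M[C]_n) : psd A -> exists B : 'M[C]_n, A = B^t* *m B.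
Proof.
move=> pA; have [hA _] := pA.
have d0 : forall i, 0 <= spectral_diag A 0 i.
  by apply: diag_mx_psdP; rewrite -(spectral_diagE hA); apply: psd_conj.
exists (diag_mx (map_mx sqrtC (spectral_diag A)) *m spectralmx A).
rewrite [LHS](spectralE hA) adjM mulmxA; congr (_ *m _).
rewrite -mulmxA; congr (_ *m _).
rewrite tr_diag_mx map_diag_mx mulmx_diag; congr diag_mx.
apply/rowP => i; rewrite !mxE.
have s0 : 0 <= sqrtC (spectral_diag A 0 i) by rewrite sqrtC_ge0.
by rewrite /= (geC0_conj s0) -expr2 sqrtCK.
Qed.

End Gram.

Lemma det_mx22 (F : comNzRingType) (M : 'M[F]_2) :
  \det M = M 0 0 * M 1 1 - M 0 1 * M 1 0.
Proof.
have e1 : lift 0 0 = 1 :> 'I_2 by apply: val_inj.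
have e0 : lift 1 0 = 0 :> 'I_2 by apply: val_inj.
rewrite (expand_det_row _ 0) !big_ord_recl big_ord0 addr0 /cofactor !det_mx11.
by rewrite !mxE /= e1 e0 expr0 expr1 mul1r mulN1r mulrN.
Qed.

Section Cramer.
Context {F : fieldType} (g00 g01 g10 g11 x y : F).
Hypothesis det_neq0 : g00 * g11 - g01 * g10 != 0.
Let N := (g00 * g11 - g01 * g10)^-1.

(** The two equations are paired by [*] so that one [rewrite] can use either; the vector identities
    reduce to them coordinatewise. *)
Lemma cramer_sourceK :
  (N * g11 * (g00 * x + g10 * y) - N * g10 * (g01 * x + g11 * y) = x) *
  (- (N * g01 * (g00 * x + g10 * y)) + N * g00 * (g01 * x + g11 * y) = y).
Proof. by rewrite /N; split; field. Qed.

Lemma cramer_labelK :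
  (g00 * (N * g11 * x - N * g10 * y) + g10 * (- (N * g01 * x) + N * g00 * y)
   = x) *
  (g01 * (N * g11 * x - N * g10 * y) + g11 * (- (N * g01 * x) + N * g00 * y)
   = y).
Proof. by rewrite /N; split; field. Qed.

End Cramer.

(** * Entries, positivity, trace and unitality of the channel *)

Section Channel.
Context {R : realType} (d n : nat).
Local Notation C := R[i].
Variable G : 'M['F_d]_2.
Hypothesis Gu : G \in unitmx.
Local Notation dits := (dits d n).
Local Notation er := (@enum_rank dits).
Implicit Types (a b c s p x y : dits) (sigma rho : 'M[C]_#|{: dits}|).

(** The inverse of [conv_label]: the label of the basis ket that [conv_unitary] sends to the ket of
    [ab]. *)
Definition conv_source (ab : dits * dits) : dits * dits :=
  (G 0 0 *: ab.1 + G 1 0 *: ab.2, G 0 1 *: ab.1 + G 1 1 *: ab.2).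

Lemma conv_det_neq0 : G 0 0 * G 1 1 - G 0 1 * G 1 0 != 0.
Proof. by rewrite -det_mx22 -unitfE. Qed.

Lemma conv_sourceK : cancel conv_source (fun ij => conv_label G ij.1 ij.2).
Proof.
move=> [a b]; rewrite /conv_label /conv_source /= det_mx22.
congr (_, _); apply/rowP => k; rewrite !mxE;
  by rewrite (cramer_sourceK _ _ conv_det_neq0).
Qed.

Lemma conv_labelK : cancel (fun ij => conv_label G ij.1 ij.2) conv_source.
Proof.
move=> [a b]; rewrite /conv_label /conv_source /= det_mx22.
congr (_, _); apply/rowP => k; rewrite !mxE;
  by rewrite (cramer_labelK _ _ conv_det_neq0).
Qed.

Lemma conv_unitaryE (x y : dits * dits) :
  (conv_unitary n G : 'M[C]__) (enum_rank x) (enum_rank y)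
  = 1 * (x == conv_label G y.1 y.2)%:R.
Proof.
have ketE z : (ket (conv_label G z.1 z.2) *m (ket (z.1, z.2))^t* : 'M[C]__)
    (enum_rank x) (enum_rank y) = ((x == conv_label G z.1 z.2) && (y == z))%:R.
  rewrite /ket trmx_delta map_delta_mx mul_delta_mx !mxE !(can_eq enum_rankK).
  by rewrite -surjective_pairing.
rewrite mul1r /conv_unitary pair_big /= summxE (bigD1 y) //= ketE eqxx andbT.
rewrite big1 ?addr0 // => z zy; rewrite ketE.
by rewrite [y == z]eq_sym (negPf zy) andbF.
Qed.

(** The unitary permutes basis kets, so conjugation pulls both indices back along [conv_source]; the
    sum over [b] is the partial trace. *)
Lemma conv_channelE sigma rho a c :
  conv_channel G sigma rho (er a) (er c) = \sum_b
    rho (er (conv_source (a, b)).1) (er (conv_source (c, b)).1)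
    * sigma (er (conv_source (a, b)).2) (er (conv_source (c, b)).2).
Proof.
rewrite mxE; apply: eq_bigr => b _; rewrite !enum_rankK.
rewrite (monomial_conjE conv_labelK conv_sourceK conv_unitaryE).
by rewrite !mxE !enum_rankK rmorph1 !mul1r.
Qed.

Lemma conv_channel_lincomb sigma (I : finType) (p : I -> C)
    (rho : I -> 'M[C]_#|{: dits}|) :
  conv_channel G sigma (\sum_i p i *: rho i)
  = \sum_i p i *: conv_channel G sigma (rho i).
Proof.
apply: matrix_enum_rankP => a c; rewrite conv_channelE summxE.
under eq_bigr do rewrite summxE mulr_suml.
rewrite exchange_big; apply: eq_bigr => i _; rewrite mxE conv_channelE mulr_sumr.
by apply: eq_bigr => b _; rewrite mxE mulrA.
Qed.

(** For Gram factors B of [rho] and E of [sigma], the output is a sum of Gram matrices of row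
    vectors, indexed by the traced-out label b, a row k of B and a row l of E. *)
Lemma conv_channel_psd sigma rho : psd sigma -> psd rho ->
  psd (conv_channel G sigma rho).
Proof.
move=> /psd_gram [E ->] /psd_gram [B ->].
pose v b k l : 'rV[C]_#|{: dits}| :=
  \row_x (B k (er (conv_source (enum_val x, b)).1)
          * E l (er (conv_source (enum_val x, b)).2)).
suff -> : conv_channel G (E^t* *m E) (B^t* *m B)
    = \sum_b \sum_k \sum_l (v b k l)^t* *m v b k l.
  by do 3 apply: psd_sum => ?; apply: gram_psd.
apply: matrix_enum_rankP => a c; rewrite conv_channelE summxE.
apply: eq_bigr => b _.
rewrite summxE !mxE big_distrlr /=; apply: eq_bigr => k _.
rewrite summxE; apply: eq_bigr => l _.
rewrite !mxE big_ord1 !mxE !enum_rankK rmorphM /=; ring.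
Qed.

Lemma conv_channel_tr sigma rho :
  \tr (conv_channel G sigma rho) = \tr rho * \tr sigma.
Proof.
rewrite /mxtrace sum_enum_rank; under eq_bigr do rewrite conv_channelE.
rewrite !sum_enum_rank big_distrlr /= !pair_big /=.
rewrite [RHS](reindex conv_source) /=; last first.
  by apply: onW_bij; exists (fun ij => conv_label G ij.1 ij.2);
    [exact: conv_sourceK|exact: conv_labelK].
by apply: eq_bigr => -[a b] _.
Qed.

Lemma conv_channel_state sigma rho : is_state sigma -> is_state rho ->
  is_state (conv_channel G sigma rho).
Proof.
move=> /state_psd [ps ts] /state_psd [pr tr]; apply/state_psd; split.
  exact: conv_channel_psd.
by rewrite conv_channel_tr tr ts mulr1.
Qed.

(** On the identity, a nonzero term at (a, c) needs g00 a = g00 c, which forces a = c as g00 is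
    invertible. On the diagonal, invertibility of g11 makes b range over all diagonal entries of
    [sigma], whose trace is 1. *)
Lemma conv_channel_unital sigma : even_parity_positive G -> is_state sigma ->
  unital (conv_channel G sigma).
Proof.
move=> [g00 g11] [_ _ ts]; apply: matrix_enum_rankP => a c.
rewrite conv_channelE !mxE (can_eq enum_rankK).
have [->|ac] := eqVneq a c; last first.
  apply: big1 => b _; rewrite !mxE (can_eq enum_rankK) /=.
  rewrite (inj_eq (addIr _)) (inj_eq (scalerI g00)) (negPf ac); exact: mul0r.
rewrite -[RHS]ts /mxtrace sum_enum_rank.
rewrite [RHS](reindex (fun b => G 0 1 *: c + G 1 1 *: b)) /=; last first.
  exists (fun b => (G 1 1)^-1 *: (b - G 0 1 *: c)) => b _.
    by rewrite [_ + G 1 1 *: b]addrC addrK scalerA mulVf // scale1r.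
  by rewrite scalerA mulfV // scale1r addrCA subrr addr0.
by apply: eq_bigr => b _; rewrite mxE eqxx mul1r.
Qed.

End Channel.

(** Take chi x = w^x for a root w of 1 + X + ... + X^(d-1). Then w^d = 1, so |w| = 1, and w is not 1
    because the polynomial takes the value d there. *)
Lemma Fp_character (R : realType) (d : nat) : prime d ->
  exists chi : 'F_d -> R[i],
    [/\ {morph chi : x y / x + y >-> x * y},
        forall x, chi x * ((chi x)^*)%R = 1 & chi 1 != 1].
Proof.
move=> dp; have d_gt1 := prime_gt1 dp; have d_gt0 := prime_gt0 dp.
have [|w /eqP w0] := closed_rootP (\poly_(i < d) (1 : R[i])) _.
  by rewrite size_poly_eq ?oner_eq0 // neq_ltn d_gt1 orbT.
have {}w0 : \sum_(i < d) w ^+ i = 0.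
  by rewrite -[RHS]w0 horner_poly; apply: eq_bigr => i _; rewrite mul1r.
have wd : w ^+ d = 1 by apply/eqP; rewrite -subr_eq0 subrX1 w0 mulr0.
have w1 : w != 1.
  apply: contra_eqN w0 => /eqP ->; under eq_bigr do rewrite expr1n.
  by rewrite sumr_const card_ord pnatr_eq0 -lt0n.
have wn : w * (w^*)%R = 1.
  rewrite -normCK; apply/eqP; rewrite sqrp_eq1 // -(@pexpr_eq1 _ _ d) //.
  by rewrite -normrX wd normr1.
exists (fun x => w ^+ (x : nat)); split.
- move=> x y; have wp : w ^+ (Zp_trunc (pdiv d)).+2 = 1 by rewrite Fp_cast.
  by rewrite /= -exprD expr_mod.
- by move=> x; rewrite rmorphXn -exprMn wn expr1n.
- by [].
Qed.

(** * Weyl operators and covariance of the channel *)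

Section Weyl.
Context {R : realType} (d n : nat).
Local Notation C := R[i].
Local Notation dits := (dits d n).
Local Notation er := (@enum_rank dits).
Variable chi : 'F_d -> C.
Hypothesis chiD : {morph chi : x y / x + y >-> x * y}.
Hypothesis chiJ : forall x, chi x * ((chi x)^*)%R = 1.
Hypothesis chi1 : chi 1 != 1.
Implicit Types (p s x y v : dits) (A sigma rho : 'M[C]_#|{: dits}|).

Definition dot p x : 'F_d := \sum_k p 0 k * x 0 k.

Lemma dotDl p p' x : dot (p + p') x = dot p x + dot p' x.
Proof. by rewrite -big_split; apply: eq_bigr => k _; rewrite mxE mulrDl. Qed.

Lemma dotBr p x y : dot p (x - y) = dot p x - dot p y.
Proof. by rewrite -sumrB; apply: eq_bigr => k _; rewrite !mxE mulrBr. Qed.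

Lemma dotZ a p x : dot p (a *: x) = dot (a *: p) x.
Proof. by apply: eq_bigr => k _; rewrite !mxE mulrCA mulrA. Qed.

Lemma chiB (x y : 'F_d) : chi (x - y) = chi x * ((chi y)^*)%R.
Proof.
by have := chiD (x - y) y; rewrite subrK => ->; rewrite -mulrA chiJ mulr1.
Qed.

Lemma chi0 : chi 0 = 1.
Proof. by rewrite -(subrr 0) chiB chiJ. Qed.

(** Orthogonality of characters: for nonzero x, translating p by a [p0] with [dot p0 x = 1]
    multiplies the sum by [chi 1], which differs from 1. *)
Lemma character_sum x :
  \sum_p chi (dot p x) = #|{: dits}|%:R * (x == 0)%:R.
Proof.
have [->|x0] := eqVneq x 0.
  rewrite mulr1 -sumr_const; apply: eq_bigr => p _.
  by rewrite /dot big1 ?chi0 // => k _; rewrite mxE mulr0.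
have [k xk] : exists k, x 0 k != 0 by apply/rV0Pn.
pose p0 : dits := (x 0 k)^-1 *: delta_mx 0 k.
have dp0 : dot p0 x = 1.
  rewrite /dot (bigD1 k) //= big1 ?addr0 => [|l lk].
    by rewrite !mxE !eqxx mulr1 mulVf.
  by rewrite !mxE eqxx (negPf lk) mulr0 mul0r.
rewrite mulr0; set S := LHS.
have : chi 1 * S = S.
  rewrite /S [RHS](reindex_inj (addrI p0)) mulr_sumr; apply: eq_bigr => p _.
  by rewrite dotDl dp0 chiD.
move/eqP; rewrite -subr_eq0 -[X in _ - X]mul1r -mulrBl mulf_eq0 subr_eq0.
by rewrite (negPf chi1) => /eqP.
Qed.

(** The Weyl operator Z(p) X(s): shift by s, then phase. *)
Definition weyl s p : 'M[C]_#|{: dits}| :=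
  \matrix_(i, j) (chi (dot p (enum_val i)) * (enum_val i == enum_val j + s)%:R).

Lemma weylE s p x y :
  weyl s p (er x) (er y) = chi (dot p x) * (x == y + s)%:R.
Proof. by rewrite mxE !enum_rankK. Qed.

Lemma weyl_conjE s p A x y :
  (weyl s p *m A *m (weyl s p)^t* ) (er x) (er y)
  = chi (dot p (x - y)) * A (er (x - s)) (er (y - s)).
Proof.
rewrite (monomial_conjE (addrK s) (subrK s) (weylE s p)).
by rewrite -chiB -dotBr.
Qed.

Lemma weyl_unitary s p : weyl s p \is unitarymx.
Proof.
apply: (monomial_unitary (addrK s) (subrK s) (weylE s p)) => x; exact: chiJ.
Qed.

(** The sum over p kills the off-diagonal entries by orthogonality; the sum over s then turns each
    diagonal entry into the trace. *)
Lemma weyl_twirl A :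
  \sum_s \sum_p weyl s p *m A *m (weyl s p)^t*
  = (#|{: dits}|%:R * \tr A) *: 1%:M.
Proof.
apply: matrix_enum_rankP => x y; rewrite summxE.
under eq_bigr do rewrite summxE.
under eq_bigr do under eq_bigr do rewrite weyl_conjE.
under eq_bigr do rewrite -mulr_suml character_sum.
rewrite -mulr_sumr subr_eq0 !mxE (can_eq enum_rankK).
have [->|_] := eqVneq x y; last by rewrite !mulr0 mul0r.
rewrite !mulr1 /mxtrace sum_enum_rank; congr (_ * _).
by rewrite [RHS](reindex_inj (subrI y)).
Qed.

Variable G : 'M['F_d]_2.
Hypothesis Gu : G \in unitmx.

(** Let (u, v) be [conv_label] of (s, 0). Shifting the first input by s shifts the outputs by u and
    v; the shift by v is absorbed in the traced-out variable. In the phase, the terms in that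
    variable cancel between the two indices, leaving p . g00 (a - c). *)
Lemma conv_channel_weyl sigma rho s p :
  conv_channel G sigma (weyl s p *m rho *m (weyl s p)^t* )
  = let W := weyl (((\det G)^-1 * G 1 1) *: s) (G 0 0 *: p) in
    W *m conv_channel G sigma rho *m W^t*.
Proof.
apply: matrix_enum_rankP => a c; rewrite /= weyl_conjE !conv_channelE //.
set u := _ *: s; pose v := - (((\det G)^-1 * G 0 1) *: s).
have suv : conv_source G (u, v) = (s, 0).
  have := conv_labelK Gu (s, 0 : dits).
  by rewrite /conv_label /= !scaler0 subr0 addr0.
have [s1 s2] : s = G 0 0 *: u + G 1 0 *: v /\ 0 = G 0 1 *: u + G 1 1 *: v.
  by case: suv.
rewrite mulr_sumr [RHS](reindex_inj (subIr v)) /=; apply: eq_bigr => b _.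
rewrite weyl_conjE mulrA; congr (_ * _ * _).
- by rewrite opprD addrACA subrr addr0 -scalerBr dotZ.
- by rewrite s1; congr (rho (er _) (er _)); rewrite !scalerBr opprD addrACA.
- by congr (sigma (er _) (er _)); rewrite !scalerBr addrACA -opprD -s2 subr0.
Qed.

End Weyl.

(** * Holevo information *)

Section Extrema.
Context {R : realType}.
Implicit Types (A : set R) (x : R).

Lemma sup_maximum A x : is_maximum A x -> sup A = x.
Proof.
move=> [Ax ubx]; apply: le_anti; apply/andP; split.
  by apply: ge_sup => //; exists x.
by apply: ub_le_sup => //; exists x.
Qed.

Lemma inf_minimum A x : is_minimum A x -> inf A = x.
Proof.
move=> [Ax lbx]; apply: le_anti; apply/andP; split.
  by apply: ge_inf => //; exists x.
by apply: lb_le_inf => //; exists x.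
Qed.

End Extrema.

Section States.
Context {R : realType}.
Local Notation C := R[i].

Lemma proj_ket_state n (psi : 'cV[C]_n) :
  unit_ket psi -> is_state (proj_ket psi).
Proof.
move=> upsi; apply/state_psd; split.
  by have := gram_psd (psi^t* ); rewrite trmxCK.
by rewrite mxtrace_mulC trace_mx11.
Qed.

Lemma state_conj n (V A : 'M[C]_n) : V \is unitarymx -> is_state A ->
  is_state (V *m A *m V^t* ).
Proof.
move=> uV /state_psd [pA tA]; apply/state_psd; split; first exact: psd_conj.
by rewrite mxtrace_mulC mulmxA (unitary_mulVmx uV) mul1mx.
Qed.

Lemma state_mix n (I : finType) (p : I -> R) (rho : I -> 'M[C]_n) :
  (forall i, 0 <= p i) -> \sum_i p i = 1 -> (forall i, is_state (rho i)) ->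
  is_state (\sum_i (p i)%:C *: rho i).
Proof.
move=> p0 p1 srho; apply/state_psd; split.
  by apply: psd_sum => i; apply: psdZ; [exact: p0|have [] := srho i].
rewrite raddf_sum /= (eq_bigr (fun i => (p i)%:C)) => [|i _].
  by rewrite -raddf_sum /= p1.
by have [_ _ ti] := srho i; rewrite mxtraceZ ti mulr1.
Qed.

(** The kets are the adjoints of the rows of the spectral unitary. This lets concavity carry a bound
    from kets to all states. *)
Lemma state_spectral n (A : 'M[C]_n) : is_state A ->
  exists (p : 'I_n -> R) (psi : 'I_n -> 'cV[C]_n),
    [/\ forall i, 0 <= p i, \sum_i p i = 1, forall i, unit_ket (psi i)
      & A = \sum_i (p i)%:C *: proj_ket (psi i)].
Proof.
move=> /state_psd [pA tA]; have [hA _] := pA.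
have d0 : forall i, 0 <= spectral_diag A 0 i.
  by apply: diag_mx_psdP; rewrite -(spectral_diagE hA); apply: psd_conj.
have E := spectralE hA; have := spectral_unitarymx A.
move: (spectralmx A) (spectral_diag A) d0 E => P d d0 E uP.
exists (fun i => complex.Re (d 0 i)), (fun i => (row i P)^t* ); split.
- by move=> i; apply: Re_ge0.
- rewrite -Re_sum (_ : \sum_i d 0 i = 1) // -tA E mxtrace_mulC mulmxA.
  by rewrite (unitary_mulmxV uP) mul1mx mxtrace_diag.
- move=> i; rewrite /unit_ket trmxCK mxE -[RHS](unitary_row_sum i uP).
  by apply: eq_bigr => j _; rewrite !mxE.
rewrite {1}E; apply/matrixP => i j; rewrite summxE mxE; apply: eq_bigr => k _.
rewrite mul_mx_diag !mxE big_ord1 ge0_RRe // !mxE conjCK.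
by rewrite mulrCA mulrA.
Qed.

End States.

Lemma card_dits (d n : nat) : prime d -> #|{: dits d n}| = (d ^ n)%N.
Proof. by move=> dp; rewrite card_mx card_Fp // mul1n. Qed.

Lemma log2X (R : realType) (x : R) n : 0 < x -> log2 (x ^+ n) = n%:R * log2 x.
Proof. by move=> x0; rewrite /log2 lnXn // [RHS]mulr_natl mulrnAl. Qed.

Theorem corollary2 (R : realType) (d n : nat) (G : 'M['F_d]_2)
    (sigma : 'M[R[i]]_#|{: dits d n}|) :
  prime d -> odd d -> (1 <= n)%N ->
  G \in unitmx -> even_parity_positive G -> is_state sigma ->
  let L := conv_channel G sigma in
  [/\ unital L,
      is_maximum (holevo_quantities L) (holevo_information L),
      is_minimum (pure_output_entropies L) (min_output_entropy L)
    & holevo_information L = n%:R * log2 d%:R - min_output_entropy L].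
Proof.
move=> dp _ _ Gu Gpos ssig L.
have Lunital : unital L by apply: conv_channel_unital.
have Lstate rho : is_state rho -> is_state (L rho).
  by move=> srho; apply: conv_channel_state.
have Lmix (I : finType) (p : I -> R[i]) rho :
    L (\sum_i p i *: rho i) = \sum_i p i *: L (rho i).
  by apply: conv_channel_lincomb.
set D := #|{: dits d n}| in sigma ssig L Lunital Lstate Lmix *.
have D0 : (0 < D)%N by apply/card_gt0P; exists 0.
have Dn0 : D%:R != 0 :> R by rewrite pnatr_eq0 -lt0n.
have logD : log2 D%:R = n%:R * log2 d%:R :> R.
  by rewrite /D card_dits // natrX log2X // ltr0n prime_gt0.
have [psi upsi psimin] : exists2 psi : 'cV_D, unit_ket psi &
    forall phi, unit_ket phi ->
      entropy (L (proj_ket psi)) <= entropy (L (proj_ket phi)).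
  apply: min_output_attained.
  - exists (delta_mx (Ordinal D0) 0).
    by rewrite /unit_ket trmx_delta map_delta_mx mul_delta_mx mxE !eqxx.
  - move=> A i j; rewrite {1}(matrix_sum_delta A) pair_big /= Lmix summxE.
    by rewrite pair_big; apply: eq_bigr => k _; rewrite mxE.
  - by move=> phi uphi; have /state_psd [] := Lstate _ (proj_ket_state uphi).
(* Minimality extends to mixed inputs: decompose into kets and use concavity. *)
have psimin_state rho : is_state rho ->
    entropy (L (proj_ket psi)) <= entropy (L rho).
  move=> /state_spectral [p [phi [p0 p1 uphi ->]]]; rewrite Lmix.
  apply: le_trans (entropy_concave p0 p1 _); last first.
    by move=> i; have /state_psd [] := Lstate _ (proj_ket_state (uphi i)).
  rewrite -[leLHS]mul1r -p1 mulr_suml; apply: ler_sum => i _.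
  apply: (ler_wpM2l (p0 i)); exact: psimin.
have Hmin : is_minimum (pure_output_entropies L) (entropy (L (proj_ket psi))).
  split; first by exists psi.
  by move=> _ [phi uphi ->]; apply: psimin.
have Hmax : is_maximum (holevo_quantities L)
    (n%:R * log2 d%:R - entropy (L (proj_ket psi))).
  (* Upper bound first: the averaged output has entropy at most log D, and each output entropy is at
     least the minimum. *)
  rewrite -logD; split; last first.
    move=> _ [k [p [rho [p0 p1 srho ->]]]]; apply: lerB.
      by apply: entropy_le_log => //; apply/Lstate/state_mix.
    rewrite -[leLHS]mul1r -p1 mulr_suml; apply: ler_sum => i _.
    apply: (ler_wpM2l (p0 i)); exact: psimin_state.
  (* The bound is attained by the uniform ensemble on the Weyl orbit of [psi]; by covariance all its
     outputs have the minimal entropy. *)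
  have [chi [chiD chiJ chi1]] := @Fp_character R d dp.
  pose W (sp : dits d n * dits d n) := weyl chi sp.1 sp.2.
  have uW sp : W sp \is unitarymx by apply: weyl_unitary.
  pose K := #|{: dits d n * dits d n}|.
  have KD : K = (D * D)%N by rewrite /K card_prod.
  have K0 : K%:R != 0 :> R by rewrite KD natrM mulf_neq0.
  pose rho (i : 'I_K) := W (enum_val i) *m proj_ket psi *m (W (enum_val i))^t*.
  have Lrho i : entropy (L (rho i)) = entropy (L (proj_ket psi)).
    have E := conv_channel_weyl chiD chiJ Gu sigma (proj_ket psi)
      (enum_val i).1 (enum_val i).2.
    have /state_psd [pL _] := Lstate _ (proj_ket_state upsi).
    apply: etrans (congr1 (@entropy R _) E) _.
    exact: entropy_unitary pL (weyl_unitary chiJ _ _).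
  have p1 : \sum_(i < K) (K%:R^-1 : R) = 1.
    by rewrite sumr_const card_ord -[_^-1 *+ _]mulr_natr mulVf.
  exists K, (fun=> K%:R^-1), rho; split; [|exact: p1| |].
  - by move=> _; rewrite invr_ge0 ler0n.
  - by move=> i; apply: state_conj (uW _) (proj_ket_state upsi).
  (* The twirl of a trace-one matrix is D times the identity, and there are D^2 Weyl operators,
     whence the factor 1/D. *)
  have -> : \sum_i (K%:R^-1 : R)%:C *: rho i = (D%:R^-1)%:C *: 1%:M.
    rewrite -scaler_sumr sum_enum_rank.
    under eq_bigr do rewrite /rho enum_rankK.
    rewrite -(pair_big xpredT xpredT
      (fun s p => W (s, p) *m proj_ket psi *m (W (s, p))^t* )) /=.
    rewrite weyl_twirl //; have [_ _ ->] := proj_ket_state upsi.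
    rewrite mulr1 scalerA KD; congr (_ *: _).
    rewrite -[D%:R in LHS](rmorph_nat (real_complex R)) -rmorphM.
    by congr (_%:C); rewrite natrM invfM -mulrA mulVf // mulr1.
  have -> : L ((D%:R^-1)%:C *: 1%:M) = (D%:R^-1)%:C *: 1%:M.
    have := Lmix 'I_1 (fun=> (D%:R^-1)%:C) (fun=> 1%:M).
    by rewrite !big_ord1 Lunital.
  rewrite entropy_maximally_mixed //; congr (_ - _).
  rewrite (eq_bigr (fun=> K%:R^-1 * entropy (L (proj_ket psi)))) => [|i _].
    by rewrite -mulr_suml p1 mul1r.
  by rewrite Lrho.
have infE := inf_minimum Hmin; have supE := sup_maximum Hmax.
by rewrite /min_output_entropy /holevo_information infE supE.
Qed.
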